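(* Let $\omega\ge k\ge 1$ be fixed integers and suppose there exists an infinite family $\mathcal{F}$ of abc-triples satisfying the $(\omega,k)$-condition. Let $\alpha\ge 0$ and $\beta>0$. Then the critical exponent is $\beta_0=\omega/k$, in the sense that $$\lim_{c\to\infty,\ (a,b,c)\in\mathcal{F}} q_C(a,b,c;\alpha,\beta)=\begin{cases}\infty & \text{if }\beta<\omega/k,\\[2pt] \dfrac{1}{\omega^{\alpha\omega/k}\,K^{1/k}} & \text{if }\beta=\omega/k,\\[6pt] 0 & \text{if }\beta>\omega/k,\end{cases}$$ for a finite constant $K$.
   Context: An abc-triple is a triple $(a,b,c)$ of positive integers with $a+b=c$ and $\gcd(a,b)=\gcd(b,c)=\gcd(a,c)=1$; $\omega(abc)$ is the number of distinct primes $p_1,\dots,p_{\omega}$ dividing $abc$. For $\alpha\ge0$, $\beta>0$, the DGM quality class is $$q_C(a,b,c;\alpha,\beta)=\frac{\ln c}{(\ln \mathrm{DGM}(U))^\beta},\qquad U=\{p_i^{\omega^\alpha}: p_i\mid abc,\ p_i\text{ prime}\},\ \omega=\omega(abc),$$ where $\mathrm{DGM}(\{x_1,\dots,x_m\})=\exp(\exp(\tfrac1m\sum_{i}\ln\ln x_i))$; equivalently $q_C(a,b,c;\alpha,\beta)=\ln c\,\big/\,\big(\omega^\alpha(\prod_{i=1}^{\omega}\ln p_i)^{1/\omega}\big)^\beta$. A family $\mathcal{F}$ of abc-triples satisfies the $(\omega,k)$-condition if $\omega(abc)=\omega$ is constant on $\mathcal{F}$, $k$ of the $\omega$ primes dividing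 $abc$ grow on the order of $\Theta(c)$, and the other $\omega-k$ primes are uniformly bounded over $\mathcal{F}$.
   Formalization: At β=ω/k the limit along the whole family is claimed only if the product of ln p over the bounded primes converges to K along it (it can fail otherwise); in general the family splits into finitely many subfamilies, each with its own K. *)

(* Defs.v *)
From HB Require Import structures.
From mathcomp Require Import all_boot all_order all_algebra.
From mathcomp Require Import all_classical all_reals all_analysis.
Import Order.TTheory GRing.Theory Num.Theory.
Import numFieldNormedType.Exports.

Set Implicit Arguments.
Unset Strict Implicit.
Unset Printing Implicit Defensive.

Local Open Scope classical_set_scope.
Local Open Scope ring_scope.

Definition triple : Type := (nat * nat * nat)%type.

Definition ta (t : triple) : nat := t.1.1.
Definition tb (t : triple) : nat := t.1.2.
Definition tc (t : triple) : nat := t.2.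

Definition abc_triple : set triple := [set t |
  [/\ [&& 0 < ta t, 0 < tb t & 0 < tc t]%N,
      (ta t + tb t)%N = tc t &
      [&& coprime (ta t) (tb t), coprime (tb t) (tc t)
        & coprime (ta t) (tc t)]]].

Definition primes_abc (t : triple) : seq nat := primes (ta t * tb t * tc t)%N.

Definition omega_abc (t : triple) : nat := size (primes_abc t).

(* A finite set of reals is given by a duplicate-free list. *)
Definition DGM (R : realType) (U : seq R) : R :=
  expR (expR ((size U)%:R^-1 * \sum_(x <- U) ln (ln x))).

Definition dgm_set (R : realType) (alpha : R) (t : triple) : seq R :=
  [seq p%:R `^ ((omega_abc t)%:R `^ alpha) | p <- primes_abc t].

Definition qC (R : realType) (alpha beta : R) (t : triple) : R :=
  ln (tc t)%:R / (ln (DGM (dgm_set alpha t)) `^ beta).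

(* The filter "c --> oo with (a, b, c) in F" on triples.  It is proper exactly
   when c is unbounded on F; otherwise it is the improper filter. *)
Definition c_to_infty (F : set triple) : set_system triple :=
  filter_from [set: nat] (fun N => [set t | F t /\ (N <= tc t)%N]).

(* The (omega, k)-condition, witnessed by p: for each t in F, p t enumerates
   without repetition the primes dividing abc (so there are exactly omega of
   them), with the k primes of order Theta(c) listed first. *)
Definition omega_k_condition (R : realType) (omega k : nat) (F : set triple)
    (p : triple -> 'I_omega -> nat) : Prop :=
  [/\ forall t, F t -> perm_eq (codom (p t)) (primes_abc t),
      forall i : 'I_omega, (i < k)%N ->
        (fun t => (p t i)%:R : R) \is
          'Theta_(c_to_infty F) (fun t => (tc t)%:R : R) &
      exists B : nat, forall (t : triple) (i : 'I_omega),
        F t -> (k <= i)%N -> (p t i <= B)%N].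

(* The product of ln p_i over the uniformly bounded primes p_i of the triple. *)
Definition bounded_ln_prod (R : realType) (omega k : nat)
    (p : triple -> 'I_omega -> nat) (t : triple) : R :=
  \prod_(i < omega | (k <= i)%N) ln (p t i)%:R.

Definition critical_value (R : realType) (alpha : R) (omega k : nat) (K : R)
    : R :=
  1 / (omega%:R `^ (alpha * omega%:R / k%:R) * K `^ (1 / k%:R)).

(* Main.v *)
(* Put L = ln ln c.  Taking logarithms,
     ln q_C = L - beta (alpha ln omega + omega^-1 \sum_i ln ln p_i).
   A prime p_i of order Theta(c) has ln p_i / ln c --> 1, hence contributes
   ln ln p_i = L + o(1), while the bounded primes contribute ln P, where
   P = bounded_ln_prod takes finitely many positive values.  Therefore
     ln q_C = (1 - beta k / omega) L - beta alpha ln omega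
                - (beta / omega) ln P + o(1),
   and the sign of 1 - beta k / omega decides the limit. *)
Require Import Defs.
From HB Require Import structures.
From mathcomp Require Import all_boot all_order all_algebra.
From mathcomp Require Import all_classical all_reals all_analysis.
From mathcomp Require Import ring lra.
Import Order.TTheory GRing.Theory Num.Theory.
Import numFieldNormedType.Exports.
Set Implicit Arguments.
Unset Strict Implicit.
Unset Printing Implicit Defensive.
Local Open Scope classical_set_scope.
Local Open Scope ring_scope.

(** * The filter of large c along a family *)

Instance c_to_infty_filter (F : set triple) : Filter (c_to_infty F).
Proof.
apply: filter_from_filter; first by exists 0%N.
move=> i j _ _; exists (maxn i j) => // t [Ft].
by rewrite geq_max => /andP[it jt]; split; split.
Qed.

Lemma c_to_infty_in (F : set triple) : \forall t \near c_to_infty F, F t.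
Proof. by exists 0%N => // t []. Qed.

Lemma c_to_infty_ge (F : set triple) N :
  \forall t \near c_to_infty F, (N <= tc t)%N.
Proof. by exists N => // t []. Qed.

Lemma c_to_inftyS (F G : set triple) :
  F `<=` G -> c_to_infty F --> c_to_infty G.
Proof.
by move=> FG A [N _ NA]; exists N => // t [Ft Nt]; apply: NA; split=> //; apply: FG.
Qed.

(** Since a + b = c, both a and b are at most c, so only finitely many abc-triples lie below any
    bound on c; an infinite family therefore has c unbounded. *)
Lemma c_to_infty_proper (F : set triple) :
  F `<=` abc_triple -> infinite_set F -> ProperFilter (c_to_infty F).
Proof.
move=> Fabc Finf; apply: filter_from_proper => N _.
apply: contrapT => noF; apply: Finf.
apply: (@sub_finite_set _ _ (`I_N `*` `I_N `*` `I_N)); last first.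
  by do 2?apply: finite_setX; exact: finite_II.
move=> t Ft; have [_ abc _] := Fabc _ Ft.
have ltN : (tc t < N)%N by rewrite ltnNge; apply/negP => ?; apply: noF; exists t.
by split=> //=; split=> /=; apply: leq_ltn_trans ltN; rewrite -abc ?leq_addr ?leq_addl.
Qed.

Lemma tc_cvgy (R : realType) (F : set triple) :
  (tc t)%:R @[t --> c_to_infty F] --> (+oo : set_system R).
Proof.
apply/cvgryPge => A; apply: filterS (c_to_infty_ge F (Num.truncn A).+1) => t At.
have : A < (Num.truncn A).+1%:R by exact: truncnS_gt.
by move=> /ltW/le_trans; apply; rewrite ler_nat.
Qed.

(** * Limits involving logarithms *)

Lemma ln_cvgy {R : realType} : ln x @[x --> +oo] --> (+oo : set_system R).
Proof.
apply/cvgryPge => A; near=> x; rewrite -[A]expRK ler_ln ?posrE ?expR_gt0//.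
Unshelve. all: by end_near. Qed.

Lemma cvgy_affine {R : realType} {T : Type} {G : set_system T} {FG : Filter G}
    (f : T -> R) (a : R) : 0 < a -> f t @[t --> G] --> +oo ->
  forall b, a * f t + b @[t --> G] --> +oo.
Proof.
move=> a0 /cvgryPge fy b; apply/cvgryPge => A.
by apply: filterS (fy ((A - b) / a)) => t; rewrite ler_pdivrMr// lerBlDr mulrC.
Qed.

Lemma ln_prod {R : realType} {I : Type} (r : seq I) (P : pred I) (f : I -> R) :
  (forall i, P i -> 0 < f i) ->
  ln (\prod_(i <- r | P i) f i) = \sum_(i <- r | P i) ln (f i).
Proof.
move=> f0; rewrite -[RHS]expRK expR_sum; congr ln.
by apply: eq_bigr => i Pi; rewrite lnK// posrE f0.
Qed.

(** Constant factors shift [ln] by bounded amounts, so ln f / ln g is squeezed to 1; a second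
    logarithm turns this ratio into a difference tending to ln 1 = 0. *)
Lemma ln_ln_theta {R : realType} {T : Type} {G : set_system T} {FG : Filter G}
    (f g : T -> R) (k1 k2 : R) :
  0 < k1 -> 0 < k2 -> g t @[t --> G] --> +oo ->
  (\forall t \near G, k1 * g t <= f t <= k2 * g t) ->
  ln (ln (f t)) - ln (ln (g t)) @[t --> G] --> (0 : R).
Proof.
move=> k1_gt0 k2_gt0 gy fg.
have lgy : ln (g t) @[t --> G] --> +oo by exact: cvg_comp gy ln_cvgy.
have ilg : (ln (g t))^-1 @[t --> G] --> (0 : R).
  by apply/gtr0_cvgV0 => //; near=> t; near: t; exact: cvgry_gt lgy _.
have ratio : ln (f t) / ln (g t) @[t --> G] --> (1 : R).
  have lim k : 1 + ln k * (ln (g t))^-1 @[t --> G] --> (1 : R).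
    rewrite -[X in _ --> X]addr0 -[X in 1 + X](mulr0 (ln k)).
    by apply: cvgD; [exact: cvg_cst|exact: cvgMl_tmp].
  apply: squeeze_cvgr (lim k1) (lim k2).
  near=> t.
  have g0 : 0 < g t by near: t; exact: cvgry_gt gy _.
  have lg0 : 0 < ln (g t) by near: t; exact: cvgry_gt lgy _.
  have /andP[f1 f2] : k1 * g t <= f t <= k2 * g t by near: t.
  have f0 : 0 < f t by apply: lt_le_trans f1; exact: mulr_gt0.
  have E k : 0 < k -> 1 + ln k / ln (g t) = ln (k * g t) / ln (g t).
    by move=> k0; rewrite lnM ?posrE// mulrDl divff ?gt_eqF// addrC.
  rewrite !E// !ler_pM2r ?invr_gt0// !ler_ln ?posrE ?f1 ?f2//; exact: mulr_gt0.
have : ln (ln (f t) / ln (g t)) @[t --> G] --> ln (1 : R).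
  by apply: cvg_comp ratio _; exact: continuous_ln.
rewrite ln1; apply: cvg_trans; apply: near_eq_cvg; near=> t.
have lg0 : 0 < ln (g t) by near: t; exact: cvgry_gt lgy _.
(* Any positive threshold below 1 would do: it forces ln f > 0, so that the logarithm of the
   quotient splits. *)
have : 2^-1 < ln (f t) / ln (g t) by near: t; apply: cvgr_gt ratio _ _; lra.
move=> /(lt_trans _) r0.
have lf0 : 0 < ln (f t) by rewrite -(pmulr_lgt0 _ (_ : 0 < (ln (g t))^-1)) ?invr_gt0// r0; lra.
by rewrite ln_div.
Unshelve. all: by end_near. Qed.

(** * The quality as an exponential *)

Lemma prime_abc_gt1 (omega : nat) (p : 'I_omega -> nat) (t : triple) i :
  perm_eq (codom p) (primes_abc t) -> (1 < p i)%N.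
Proof.
move=> pE; have : p i \in codom p by exact: codom_f.
by rewrite (perm_mem pE) mem_primes => /andP[/prime_gt1].
Qed.

Lemma ln_nat_gt0 (R : realType) n : (1 < n)%N -> 0 < ln (n%:R : R).
Proof. by move=> n1; rewrite ln_gt0// (ltr_nat _ 1). Qed.

Lemma qC_expR (R : realType) (alpha beta : R) (omega : nat)
    (p : 'I_omega -> nat) (t : triple) :
  (0 < omega)%N -> perm_eq (codom p) (primes_abc t) -> (1 < tc t)%N ->
  qC alpha beta t = expR (ln (ln (tc t)%:R) - beta * (alpha * ln omega%:R +
    omega%:R^-1 * \sum_(i < omega) ln (ln (p i)%:R))).
Proof.
move=> w0 pE c1.
have wE : omega_abc t = omega.
  by rewrite /omega_abc -(perm_size pE) size_codom card_ord.
have lc := ln_nat_gt0 R c1.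
rewrite /qC expRD lnK ?posrE//; congr (_ * _).
rewrite expRN mulrC expRM; congr (_ `^ _)^-1.
have w0' : (0 : R) < omega%:R by rewrite ltr0n.
rewrite /DGM expRK; congr expR.
rewrite /dgm_set size_map -/(omega_abc t) wE big_map -(perm_big _ pE)/=.
rewrite big_map enumT -/(index_enum _).
(* The exponent omega^alpha adds the same term alpha ln omega to each ln ln p, so averaging over the
   omega primes leaves that term unchanged. *)
transitivity (omega%:R^-1 *
  \sum_(i < omega) (alpha * ln omega%:R + ln (ln (p i)%:R)) : R).
  congr (_ * _); apply: eq_bigr => i _.
  have lp := ln_nat_gt0 R (prime_abc_gt1 i pE).
  by rewrite ln_powR lnM ?posrE ?powR_gt0// ln_powR.
rewrite big_split/= sumr_const card_ord mulrDr -(mulr_natl (_ * _)) mulKf ?gt_eqF//.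
Qed.

(** * Contributions of the bounded and of the large primes *)

Section AlongFamily.
Variables (R : realType) (omega k : nat) (F : set triple).
Variable p : triple -> 'I_omega -> nat.
Hypothesis F_cond : omega_k_condition R k F p.

Lemma ln_bounded_ln_prod t : F t ->
  ln (bounded_ln_prod R k p t) = \sum_(i < omega | (k <= i)%N) ln (ln (p t i)%:R).
Proof.
have [pE _ _] := F_cond => /pE {}pE.
by apply: ln_prod => i _; apply/ln_nat_gt0/(prime_abc_gt1 _ pE).
Qed.

Lemma bounded_ln_prod_finite : exists Ks : seq R,
  (forall t, F t -> bounded_ln_prod R k p t \in Ks) /\
  (forall K, K \in Ks -> 0 < K).
Proof.
have [pE _ [B pB]] := F_cond.
pose V (g : {ffun 'I_omega -> 'I_B.+1}) : R :=
  \prod_(i < omega | (k <= i)%N) ln (g i)%:R.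
(* Entries 0 and 1 have logarithm 0; excluding them makes every listed product positive. *)
pose P (g : {ffun 'I_omega -> 'I_B.+1}) :=
  [forall i : 'I_omega, (k <= i)%N ==> (1 < g i)%N].
exists [seq V g | g <- enum P]; split=> [t Ft|K /mapP[g]]; last first.
  rewrite mem_enum => /forallP Pg ->; apply: prodr_gt0 => i ki.
  by apply: ln_nat_gt0; exact: implyP (Pg i) ki.
(* For i < k the prime may exceed B and [inord] then returns a junk value, but [V] and [P] read only
   the indices from k on. *)
pose g := [ffun i : 'I_omega => inord (p t i) : 'I_B.+1].
have gE (i : 'I_omega) : (k <= i)%N -> g i = p t i :> nat.
  by move=> ki; rewrite ffunE inordK// ltnS pB.
apply/mapP; exists g.
  rewrite mem_enum; apply/forallP => i; apply/implyP => ki.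
  by rewrite gE//; exact: prime_abc_gt1 _ (pE _ Ft).
by apply: eq_bigr => i ki; rewrite gE.
Qed.

Lemma ln_bounded_ln_prod_bounded : exists M : R,
  forall t, F t -> `|ln (bounded_ln_prod R k p t)| <= M.
Proof.
have [Ks [KsP _]] := bounded_ln_prod_finite.
exists (\sum_(K <- Ks) `|ln K|) => t /KsP KsK.
by rewrite (big_rem _ KsK)/= lerDl sumr_ge0.
Qed.

Let err t : R :=
  \sum_(i < omega | (i < k)%N) (ln (ln (p t i)%:R) - ln (ln (tc t)%:R)).

Lemma large_primes_cvg0 : err t @[t --> c_to_infty F] --> (0 : R).
Proof.
have <- : \sum_(i < omega | (i < k)%N) 0 = 0 :> R by rewrite big1.
apply: cvg_big => [|i ik]; first exact: add_continuous.
have [_ /(_ i ik) + _] := F_cond.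
move=> /asboolP[[k1 k2] /= /andP[k1_gt0 k2_gt0] th].
apply: ln_ln_theta k1_gt0 k2_gt0 (@tc_cvgy R F) _.
by apply: filterS th => t; rewrite !normr_nat => -[-> ->].
Qed.

(** * Asymptotics of the quality and the three regimes *)

Hypotheses (k_gt0 : (0 < k)%N) (k_le_omega : (k <= omega)%N).
Variables alpha beta : R.

Lemma qC_asymptotic : exists2 e : triple -> R,
  e t @[t --> c_to_infty F] --> (0 : R) &
  \forall t \near c_to_infty F, qC alpha beta t =
    expR ((1 - beta * k%:R / omega%:R) * ln (ln (tc t)%:R)
      - beta * (alpha * ln omega%:R)
      - beta / omega%:R * ln (bounded_ln_prod R k p t) + e t).
Proof.
exists (fun t => - (beta / omega%:R) * err t).
  by rewrite -[X in _ --> X](mulr0 (- (beta / omega%:R)));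
    apply: cvgMl_tmp; exact: large_primes_cvg0.
have [pE _ _] := F_cond; near=> t.
have Ft : F t by near: t; exact: c_to_infty_in.
rewrite (@qC_expR _ _ _ _ (p t)) ?(leq_trans k_gt0)//; last 2 first.
- exact: pE.
- by near: t; exact: c_to_infty_ge.
congr expR; rewrite ln_bounded_ln_prod// /err sumrB sumr_const.
(* The first k terms sum to k ln ln c plus [err], the others to the logarithm of the bounded
   product. *)
rewrite (bigID (fun i : 'I_omega => (i < k)%N))/=.
under [\sum_(i < omega | ~~ _) _]eq_bigl do rewrite -leqNgt.
have -> : #|[pred i : 'I_omega | (i < k)%N]| = k.
  by rewrite -sum1_card (big_ord_narrow k_le_omega) sum1_card card_ord.
have : (omega%:R : R) != 0 by rewrite pnatr_eq0 -lt0n (leq_trans k_gt0).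
rewrite -(mulr_natr (ln _)) => w0; field.
Unshelve. all: by end_near. Qed.

Lemma lnln_tc_cvgy :
  ln (ln (tc t)%:R) @[t --> c_to_infty F] --> (+oo : set_system R).
Proof.
have lnc : ln (tc t)%:R @[t --> c_to_infty F] --> (+oo : set_system R).
  exact: cvg_comp (@tc_cvgy R F) ln_cvgy.
exact: cvg_comp lnc ln_cvgy.
Qed.

(** At beta = omega / k the coefficient of ln ln c vanishes and continuity of [expR] gives the
    limit. The subfamily [G] is there because the bounded product need not converge along all of
    [F]. *)
Lemma qC_cvg_critical (G : set triple) (K : R) : G `<=` F ->
  beta = omega%:R / k%:R -> 0 < K ->
  bounded_ln_prod R k p t @[t --> c_to_infty G] --> K ->
  qC alpha beta t @[t --> c_to_infty G] --> critical_value alpha omega k K.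
Proof.
move=> /c_to_inftyS GF betaE K_gt0 PK; have [e e0 qE] := qC_asymptotic.
have k0 : (k%:R : R) != 0 by rewrite pnatr_eq0 -lt0n.
have w_gt0 : (0 : R) < omega%:R by rewrite ltr0n (leq_trans k_gt0).
have -> : critical_value alpha omega k K =
    expR (- (beta * (alpha * ln omega%:R)) - beta / omega%:R * ln K + 0).
  rewrite addr0 expRD /critical_value !div1r invfM /powR !gt_eqF// -!expRN betaE.
  by congr (expR _ * expR _); field; rewrite ?k0 ?gt_eqF.
have qE' := GF _ qE.
have {}e0 : e t @[t --> c_to_infty G] --> (0 : R) by apply: cvg_trans e0; exact: cvg_app.
have lnP : ln (bounded_ln_prod R k p t) @[t --> c_to_infty G] --> ln K.
  by apply: cvg_comp PK _; exact: continuous_ln.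
have lim : - (beta * (alpha * ln omega%:R))
      - beta / omega%:R * ln (bounded_ln_prod R k p t) + e t
    @[t --> c_to_infty G] -->
    - (beta * (alpha * ln omega%:R)) - beta / omega%:R * ln K + 0.
  by apply: cvgD e0; apply: cvgB; [exact: cvg_cst|exact: cvgMl_tmp lnP].
have := cvg_comp _ _ lim (@continuous_expR R _).
apply: cvg_trans; apply: near_eq_cvg.
apply: filterS qE' => t /= ->; congr (expR (_ + _)); rewrite betaE.
by field; rewrite k0 gt_eqF.
Qed.

(** Pointwise positivity could be lost in the limit; the uniform lower bound exp(-M) survives it,
    the filter being proper. *)
Lemma bounded_ln_prod_lim_gt0 (K : R) : ProperFilter (c_to_infty F) ->
  bounded_ln_prod R k p t @[t --> c_to_infty F] --> K -> 0 < K.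
Proof.
move=> FF PK; have [Ks [PKs Ks_gt0]] := bounded_ln_prod_finite.
have [M PM] := ln_bounded_ln_prod_bounded.
apply: lt_le_trans (expR_gt0 (- M)) _; apply: cvgr_to_ge PK _.
apply: filterS (c_to_infty_in F) => t Ft.
rewrite -[leRHS]lnK ?posrE ?ler_expR; last by apply: Ks_gt0; exact: PKs.
by have := PM t Ft; rewrite ler_norml => /andP[].
Qed.

(** All terms other than the multiple of ln ln c are bounded, so away from the critical exponent
    only the sign of its coefficient matters. *)
Lemma qC_bounds : exists C : R, \forall t \near c_to_infty F,
  let x := (1 - beta * k%:R / omega%:R) * ln (ln (tc t)%:R) in
  expR (x - C) <= qC alpha beta t <= expR (x + C).
Proof.
have [e e0 qE] := qC_asymptotic.
have [M PM] := ln_bounded_ln_prod_bounded.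
exists (`|beta * (alpha * ln omega%:R)| + `|beta / omega%:R| * M + 1).
have e1 : \forall t \near c_to_infty F, `|e t| < 1.
  by apply: (cvgr_norm_lt _ e0); rewrite normr0.
apply: filterS3 qE e1 (c_to_infty_in F) => t /= -> {}e1 Ft.
rewrite !ler_expR -2!(addrA (_ * _)) !lerD2l -ler_norml.
rewrite (le_trans (ler_normD _ _))// lerD ?(ltW e1)//.
rewrite (le_trans (ler_normD _ _))// !normrN lerD//.
by rewrite normrM ler_wpM2l// PM.
Qed.

Lemma qC_cvgy : beta < omega%:R / k%:R ->
  qC alpha beta t @[t --> c_to_infty F] --> +oo.
Proof.
move=> beta_lt; have [C CE] := qC_bounds.
have a0 : 0 < 1 - beta * k%:R / omega%:R.
  by rewrite subr_gt0 ltr_pdivrMr ?ltr0n ?(leq_trans k_gt0)// mul1r -ltr_pdivlMr ?ltr0n.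
apply: ger_cvgy _ (cvgy_affine a0 lnln_tc_cvgy (- C)).
apply: filterS CE => t /andP[+ _]; apply: le_trans.
(* The inequality exp x >= 1 + x reduces divergence to that of the exponent. *)
by apply: le_trans (expR_ge1Dx _); rewrite lerDr.
Qed.

Lemma qC_cvg0 : omega%:R / k%:R < beta ->
  qC alpha beta t @[t --> c_to_infty F] --> (0 : R).
Proof.
move=> beta_gt; have [C CE] := qC_bounds.
have a0 : 0 < beta * k%:R / omega%:R - 1.
  by rewrite subr_gt0 ltr_pdivlMr ?ltr0n ?(leq_trans k_gt0)// mul1r -ltr_pdivrMr ?ltr0n.
have lim : expR (- ((beta * k%:R / omega%:R - 1) * ln (ln (tc t)%:R) - C))
    @[t --> c_to_infty F] --> (0 : R).
  exact: cvg_comp (cvgy_affine a0 lnln_tc_cvgy (- C)) (@cvgr_expR R).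
apply: squeeze_cvgr (cvg_cst (0 : R)) lim.
apply: filterS CE => t /andP[lo up]; rewrite (le_trans _ lo) ?expR_ge0//=.
by apply: le_trans up _; rewrite ler_expR opprD opprK lerD2r -(mulNr (_ - 1)) opprB.
Qed.
End AlongFamily.

Unset Implicit Arguments.
Theorem theorem4p4 (R : realType) (omega k : nat)
    (k_gt0 : (1 <= k)%N) (k_le_omega : (k <= omega)%N)
    (F : set triple) (p : triple -> 'I_omega -> nat)
    (F_abc : F `<=` abc_triple) (F_inf : infinite_set F)
    (F_cond : omega_k_condition R k F p)
    (alpha beta : R) (alpha_ge0 : 0 <= alpha) (beta_gt0 : 0 < beta) :
  [/\ beta < omega%:R / k%:R ->
        qC alpha beta t @[t --> c_to_infty F] --> +oo,
      beta = omega%:R / k%:R ->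
        (* along F itself, K being the limit of the product of the logarithms
           of the bounded primes *)
        (forall K : R,
           bounded_ln_prod R k p t @[t --> c_to_infty F] --> K ->
           0 < K /\
           qC alpha beta t @[t --> c_to_infty F]
             --> critical_value alpha omega k K) /\
        (* in general that product takes finitely many values K on F, and the
           limit holds with constant K along each corresponding subfamily *)
        (exists Ks : seq R,
           (forall t, F t -> bounded_ln_prod R k p t \in Ks) /\
           (forall K : R, K \in Ks ->
              0 < K /\
              qC alpha beta t
                @[t --> c_to_infty (F `&` [set t | bounded_ln_prod R k p t = K])]
                --> critical_value alpha omega k K)) &
      omega%:R / k%:R < beta ->
        qC alpha beta t @[t --> c_to_infty F] --> 0].

Proof.
have FF := c_to_infty_proper F_abc F_inf.
split=> [beta_lt|betaE|beta_gt]; first exact: (qC_cvgy F_cond).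
  have [Ks [PKs Ks_gt0]] := bounded_ln_prod_finite F_cond.
  split=> [K PK|].
    have K_gt0 := bounded_ln_prod_lim_gt0 F_cond FF PK; split=> //.
    exact: (qC_cvg_critical F_cond k_gt0 k_le_omega _ betaE K_gt0 PK).
  exists Ks; split=> // K /Ks_gt0 K_gt0; split=> //.
  apply: (qC_cvg_critical F_cond k_gt0 k_le_omega _ betaE K_gt0); first by move=> t [].
  (* On this subfamily the bounded product is constantly [K]. *)
  by apply: cvg_near_cst; apply: filterS (c_to_infty_in _) => t [].
exact: (qC_cvg0 F_cond).
Qed.
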